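(* Let $\mathcal H$ be a real separable Hilbert space, let $T:\mathcal H\to\mathcal H$ be $\alpha$-averaged for some $\alpha\in(0,1]$ with $\operatorname{fix}T\neq\emptyset$, and let $R=\mathrm{id}-T$. Consider the iterates $(x_k)_{k\in\mathbb N}$ generated by the SuperMann scheme (described in the context) with directions $(d_k)_{k\in\mathbb N}$ such that, for some constant $D\ge0$, $$\|d_k\|\le D\|Rx_k\|\qquad\forall k\in\mathbb N .$$ Then: (i) $(x_k)_{k\in\mathbb N}$ is quasi-Fejér monotone with respect to $\operatorname{fix}T$; (ii) $\tau_k=1$ if $d_k=0$, and $\tau_k\ge\min\bigl\{\beta\frac{1-\sigma}{4\alpha D},\,1\bigr\}$ otherwise; (iii) $Rx_k\to0$, with $\sum_{k\in\mathbb N}\|Rx_k\|^2<\infty$; (iv) $(x_k)_{k\in\mathbb N}$ converges weakly to a point $x_\star\in\operatorname{fix}T$; (v) if $c_0>0$, the number of blind updates (step 3) is infinite. Moreover, if $(x_k)_{k\in\mathbb N}$ converges strongly to a point $x_\star$ (this being true if $\mathcal H$ is finite dimensional) at which $R$ is metrically subregular, then (vi) $(x_k)_{k\in\mathbb N}$ and $(Rx_k)_{k\in\mathbb N}$ are $R$-linearly convergent.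
   Context: An operator $T$ is nonexpansive if $\|Tx-Ty\|\le\|x-y\|$ for all $x,y\in\mathcal H$; it is $\alpha$-averaged, $\alpha\in(0,1)$, if $T=(1-\alpha)\mathrm{id}+\alpha S$ for some nonexpansive $S:\mathcal H\to\mathcal H$; $1$-averaged means nonexpansive. $\operatorname{fix}T=\{z: Tz=z\}=\operatorname{zer}R=\{z:Rz=0\}$. Quasi-Fejér monotone with respect to a nonempty set $S$: for every $s\in S$ there is a summable sequence of positive numbers $(\varepsilon_k(s))_{k}$ such that $\|x_{k+1}-s\|^2\le\|x_k-s\|^2+\varepsilon_k(s)$ for all $k\in\mathbb N$. $R$ is metrically subregular at $\bar x\in\operatorname{zer}R$ if there exist $\varepsilon,\gamma>0$ such that $\operatorname{dist}(x,\operatorname{zer}R)\le\gamma\|Rx\|$ for all $x$ with $\|x-\bar x\|<\varepsilon$. A sequence $(u_k)$ converging to $u$ is $R$-linearly convergent if there are $C>0$, $r\in(0,1)$ with $\|u_k-u\|\le Cr^k$ for all $k$. SuperMann scheme. Parameters: $x_0\in\mathcal H$, $c_0,c_1,q\in[0,1)$, $\beta,\sigma\in(0,1)$, $\lambda\in(0,1/\alpha)$. Initialize $\eta_0=r_{\rm safe}=\|Rx_0\|$, $k=0$. Step 1. If $Rx_k=0$, stop. Step 2. Choose an update direction $d_k\in\mathcal H$. Step 3 (blind update, $k\in K_0$). If $\|Rx_k\|\le c_0\eta_k$, set $\eta_{k+1}=\|Rx_k\|$, $x_{k+1}=w_k:=x_k+d_k$ (the full step, $\tau_k=1$), and go to step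 6. Step 4. Otherwise set $\eta_{k+1}=\eta_k$ and $\tau_k=1$. Step 5. Let $w_k=x_k+\tau_kd_k$. (a) (educated update, $k\in K_1$) If $\|Rx_k\|\le r_{\rm safe}$ and $\|Rw_k\|\le c_1\|Rx_k\|$, set $x_{k+1}=w_k$, update $r_{\rm safe}=\|Rw_k\|+q^k$, and go to step 6. (b) (safeguard update, $k\in K_2$) Else, if $\rho_k:=\|Rw_k\|^2-2\alpha\langle Rw_k,w_k-x_k\rangle\ge\sigma\|Rw_k\|\|Rx_k\|$, set $x_{k+1}=x_k-\lambda\frac{\rho_k}{\|Rw_k\|^2}Rw_k$ and go to step 6; otherwise replace $\tau_k\gets\beta\tau_k$ and repeat step 5. Step 6. Set $k\gets k+1$ and go to step 1. In the statement $\tau_k$ denotes the final (accepted) stepsize. Standing assumption: no solution is found in finitely many steps, i.e. $Rx_k\ne0$ for all $k$ and $Rw_k\neq0$ for all candidate points $w_k$. *)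

(* Defs.v *)
From HB Require Import structures.
From mathcomp Require Export all_boot all_order all_algebra.
From mathcomp Require Export all_classical all_reals all_analysis.
Export numFieldNormedType.Exports.

Set Implicit Arguments.
Unset Strict Implicit.
Unset Printing Implicit Defensive.
Import Order.TTheory GRing.Theory Num.Theory.
Local Open Scope classical_set_scope.
Local Open Scope ring_scope.

(* A real Hilbert space is a complete normed module [H] over a [realType]
   together with a positive definite symmetric bilinear form ([{dot H for idfun}])
   that induces the norm of [H]. *)
Definition induces_norm (K : realType) (H : completeNormedModType K)
    (ip : {dot H for idfun}) : Prop :=
  forall x : H, ip x x = `|x| ^+ 2.

Definition separable_space (X : topologicalType) : Prop :=
  exists A : set X, countable A /\ dense A.

Definition finite_dimensional (K : realType) (H : lmodType K) : Prop :=
  exists (n : nat) (b : 'I_n -> H),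
    forall v : H, exists a : 'I_n -> K, v = \sum_(i < n) a i *: b i.

Definition weakly_cvg (K : realType) (H : completeNormedModType K)
    (ip : {dot H for idfun}) (u : nat -> H) (l : H) : Prop :=
  forall y : H, ip (u k) y @[k --> \oo] --> ip l y.

Section Operators.
Variables (K : realType) (H : completeNormedModType K).
Implicit Types (T : H -> H) (S : set H) (u : nat -> H).

Definition nonexpansive T : Prop := forall x y, `|T x - T y| <= `|x - y|.

Definition averaged (alpha : K) T : Prop :=
  exists S : H -> H, nonexpansive S /\
    forall x, T x = (1 - alpha) *: x + alpha *: S x.

Lemma averaged1 T : averaged 1 T <-> nonexpansive T.
Proof.
split=> [[S [neS TE]] x y|neT].
  by rewrite !TE subrr !scale0r !add0r !scale1r.
by exists T; split=> // x; rewrite subrr scale0r add0r scale1r.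
Qed.

Definition fixset T : set H := [set z | T z = z].

Definition zer (Rs : H -> H) : set H := [set z | Rs z = 0].

Definition residual T : H -> H := fun x => x - T x.

Definition dist (x : H) S : K := inf [set `|x - s| | s in S].

Definition quasi_Fejer u S : Prop :=
  forall s, S s -> exists eps : nat -> K,
    [/\ forall k, 0 < eps k, cvgn (series eps) &
        forall k, `|u k.+1 - s| ^+ 2 <= `|u k - s| ^+ 2 + eps k].

Definition metrically_subregular (Rs : H -> H) (xbar : H) : Prop :=
  zer Rs xbar /\
  exists eps gamma : K, [/\ 0 < eps, 0 < gamma &
    forall x, `|x - xbar| < eps -> dist x (zer Rs) <= gamma * `|Rs x|].

Definition R_linearly_cvg u (l : H) : Prop :=
  exists C r : K, [/\ 0 < C, 0 < r < 1 & forall k, `|u k - l| <= C * r ^+ k].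

End Operators.

Section SuperMann.
Variables (K : realType) (H : completeNormedModType K).
Variables (ip : {dot H for idfun}) (T : H -> H).
Variables (alpha c0 c1 q beta sigma lambda : K).

Local Notation Rs := (residual T).

(* The candidate point of the [m]-th pass through the line search. *)
Definition trial (x d : H) (m : nat) : H := x + beta ^+ m *: d.

Definition rho (x w : H) : K :=
  `|Rs w| ^+ 2 - 2 * alpha * ip (Rs w) (w - x).

Definition educated (x : H) (rsafe : K) (w : H) : bool :=
  (`|Rs x| <= rsafe) && (`|Rs w| <= c1 * `|Rs x|).

Definition safeguard (x w : H) : bool :=
  sigma * `|Rs w| * `|Rs x| <= rho x w.

Definition accepted (x : H) (rsafe : K) (w : H) : bool :=
  educated x rsafe w || safeguard x w.

(* The line search evaluates the [m]-th candidate. *)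
Definition tested (x : H) (rsafe : K) (d : H) (m : nat) : Prop :=
  forall j, (j < m)%N -> ~~ accepted x rsafe (trial x d j).

(* The line search stops at the [m]-th candidate. *)
Definition stops_at (x : H) (rsafe : K) (d : H) (m : nat) : Prop :=
  tested x rsafe d m /\ accepted x rsafe (trial x d m).

Definition blind (x : nat -> H) (eta : nat -> K) : set nat :=
  [set k | `|Rs (x k)| <= c0 * eta k].

(* [eta k] and [rsafe k] are the values held on entering iteration [k].
   Termination of the line search is not assumed: at an iteration whose line
   search runs forever, [tau k], [w k], [x k.+1] and [rsafe k.+1] are left
   unconstrained. *)
Record superMann (x d w : nat -> H) (eta rsafe tau : nat -> K) : Prop := {
  sm_eta0 : eta 0%N = `|Rs (x 0%N)|;
  sm_rsafe0 : rsafe 0%N = `|Rs (x 0%N)|;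
  sm_blind : forall k, blind x eta k ->
    [/\ eta k.+1 = `|Rs (x k)|, rsafe k.+1 = rsafe k, tau k = 1,
        w k = x k + d k & x k.+1 = w k];
  sm_eta : forall k, ~ blind x eta k -> eta k.+1 = eta k;
  sm_search : forall k m, ~ blind x eta k ->
    stops_at (x k) (rsafe k) (d k) m ->
    tau k = beta ^+ m /\ w k = x k + tau k *: d k;
  sm_educated : forall k m, ~ blind x eta k ->
    stops_at (x k) (rsafe k) (d k) m ->
    educated (x k) (rsafe k) (w k) ->
    x k.+1 = w k /\ rsafe k.+1 = `|Rs (w k)| + q ^+ k;
  sm_safeguard : forall k m, ~ blind x eta k ->
    stops_at (x k) (rsafe k) (d k) m ->
    ~~ educated (x k) (rsafe k) (w k) ->
    x k.+1 = x k - (lambda * (rho (x k) (w k) / `|Rs (w k)| ^+ 2)) *: Rs (w k)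
    /\ rsafe k.+1 = rsafe k }.

(* No solution is met at an iterate or at a candidate point that is tested. *)
Definition no_finite_solution (x d : nat -> H) (eta rsafe : nat -> K) : Prop :=
  (forall k, Rs (x k) <> 0) /\
  (forall k m, ~ blind x eta k -> tested (x k) (rsafe k) (d k) m ->
     Rs (trial (x k) (d k) m) <> 0).

End SuperMann.

(* Main.v *)
From mathcomp Require Import ring lra.
Require Import Defs.

Set Implicit Arguments.
Unset Strict Implicit.
Unset Printing Implicit Defensive.
Import Order.TTheory GRing.Theory Num.Theory.
Local Open Scope classical_set_scope.
Local Open Scope ring_scope.

(** Write [R = id - T]. The residual is cocoercive, so a safeguarded step is a
relaxed projection onto a half-space containing the fixed points and decreases
the squared distance to each of them by a multiple of [|R x|^2]
([safeguard_step_fejer]). A blind or educated step moves by at most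
[D |R x|]; it is paid for by the bookkeeping of the scheme, because a blind step
lowers [eta] and an educated one lowers [rsafe] by at least a fixed fraction of
[|R x|], up to [q^k], so the residuals at these steps are summable ([nonfejer_summable]).
Together these give one inequality ([sqr_dist_descent]), from which follow quasi-Fejer
monotonicity, the summability of [|R x|^2] and, as [eta] would otherwise stay
constant, the infinitude of blind updates. The stepsize bound holds since
[R] is Lipschitz and a short enough step passes the safeguard test
([short_step_safeguard]).

Weak convergence ([opial]) uses asymptotic centres along filters: the minimizer
of the upper limit of [|x k - y|] exists and is unique by the parallelogram
identity, is a fixed point of [T], and is the same along every filter finer than
[\oo] because the distances to fixed points converge. In finite dimension
coordinates in an orthonormal family turn weak convergence into strong convergence.

For the linear rate ([residual_geometric]), a potential
combining the distance to the fixed points, [eta], and [rsafe] truncated at a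
multiple of the distance satisfies [V k.+1 <= rate * V k + A * q ^+ k] once the
iterates are in the region of metric subregularity. The steps have length
of the order of [|R x|], so the iterates inherit the rate of the residuals. *)

(** * Summable and geometric sequences *)

Section RealSequences.
Variable K : realType.
Implicit Types (a b t u : nat -> K) (r q : K).

Lemma summable_bounded a : cvgn (series a) ->
  exists M, forall n, series a n <= M.
Proof.
move=> /cvg_seq_bounded/bounded_fun_has_ubound[M aM].
by exists M => n; apply: aM; exists n.
Qed.

(** The partial sums of [a] telescope to at most [t 0] plus those of [b]. *)
Lemma cvgn_series_telescope a b t :
    (forall k, 0 <= a k) -> (forall k, 0 <= t k) ->
    (forall k, a k <= t k - t k.+1 + b k) ->
  cvgn (series b) -> cvgn (series a).
Proof.
move=> a0 t0 le_a /summable_bounded[M bM].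
apply: nondecreasing_is_cvgn; first exact: nondecreasing_series.
exists (t 0%N + M) => _ [n _ <-].
suff : series a n <= t 0%N - t n + series b n.
  by move/le_trans; apply; move: (t0 n) (bM n); lra.
elim: n => [|n IHn]; first by rewrite /series/= !big_geq// subrr addr0.
by rewrite !seriesSr; move: (le_a n) IHn; lra.
Qed.

(** Subtracting the partial sums of [b] turns [u] into a nonincreasing sequence
that is bounded below. *)
Lemma cvgn_of_le_addsummable u b :
    (forall k, 0 <= u k) -> (forall k, u k.+1 <= u k + b k) ->
  cvgn (series b) -> cvgn u.
Proof.
move=> u0 le_u cb; have [M bM] := summable_bounded cb.
rewrite (_ : u = (u - series b) + series b); last by rewrite subrK.
apply: is_cvgD => //; apply: nonincreasing_is_cvgn; last first.
  exists (- M) => _ [n _ <-]; rewrite !fctE.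
  by move: (u0 n) (bM n); lra.
apply/nonincreasing_seqP => n; rewrite !fctE seriesSr.
by move: (le_u n); lra.
Qed.

Lemma cvgn_series_scale c a : cvgn (series a) -> cvgn (series (fun k => c * a k)).
Proof.
move=> ca; rewrite (_ : series _ = (fun n => c * series a n)).
  exact: is_cvgMl_tmp.
by apply/funext => n; rewrite /series/= mulr_sumr.
Qed.

Lemma cvgn_series_add a b : cvgn (series a) -> cvgn (series b) ->
  cvgn (series (fun k => a k + b k)).
Proof.
move=> ca cb; rewrite (_ : series _ = series a + series b); first exact: is_cvgD.
by apply/funext => n; rewrite /series/= !fctE big_split.
Qed.

Lemma geometric_eventually u C r N : (forall k, 0 <= u k) -> 0 < r ->
    (forall k, (N <= k)%N -> u k <= C * r ^+ k) ->
  exists2 C', 0 < C' & forall k, u k <= C' * r ^+ k.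
Proof.
move=> u0 r0 uC.
have gt0 k : 0 <= u k / r ^+ k by rewrite divr_ge0// exprn_ge0// ltW.
exists (`|C| + 1 + \sum_(i < N) u i / r ^+ i).
  by rewrite ltr_wpDr ?sumr_ge0// ltr_wpDl.
move=> k; have [Nk|kN] := leqP N k.
  apply: le_trans (uC _ Nk) _; rewrite ler_wpM2r ?exprn_ge0 ?(ltW r0)//.
  have := ler_norm C; have : 0 <= \sum_(i < N) u i / r ^+ i by apply: sumr_ge0.
  lra.
rewrite -ler_pdivrMr ?exprn_gt0//.
rewrite (bigD1 (Ordinal kN))//=.
have : 0 <= \sum_(i < N | i != Ordinal kN) u i / r ^+ i by apply: sumr_ge0.
have := normr_ge0 C.
lra.
Qed.

(** Any [p] strictly between [max r q] and [1] absorbs the forcing term: with [C]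
large enough, [r C p^k + A q^k <= C p^k.+1]. *)
Lemma geometric_recurrence u A r q N : (forall k, 0 <= u k) -> 0 <= A ->
    0 <= r < 1 -> 0 <= q < 1 ->
    (forall k, (N <= k)%N -> u k.+1 <= r * u k + A * q ^+ k) ->
  exists C p, [/\ 0 < C, 0 < p < 1 & forall k, u k <= C * p ^+ k].
Proof.
move=> u0 A0 /andP[r0 r1] /andP[q0 q1] u_rec.
pose s := Num.max r q.
have rs : r <= s by rewrite le_max lexx.
have qs : q <= s by rewrite le_max lexx orbT.
have s1 : s < 1 by rewrite gt_max r1.
pose p := (1 + s) / 2.
have p1 : p < 1 by rewrite /p; lra.
have p0 : 0 < p by rewrite /p; lra.
have sp : s < p by rewrite /p; lra.
pose C := u N / p ^+ N + A / (p - r).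
have uC k : (N <= k)%N -> u k <= C * p ^+ k.
  elim: k => [|k IHk].
    rewrite leqn0 => /eqP N0; rewrite /C N0 expr0 divr1 mulr1 lerDl.
    by rewrite divr_ge0// subr_ge0; lra.
  rewrite leq_eqVlt => /predU1P[<-|]; last rewrite ltnS => Nk.
    rewrite /C mulrDl mulrVK ?unitfE ?expf_neq0 ?gt_eqF// lerDl.
    by rewrite mulr_ge0 ?exprn_ge0 ?divr_ge0 ?(ltW p0)//; lra.
  apply: le_trans (u_rec _ Nk) _.
  have pk0 : 0 <= p ^+ k by rewrite exprn_ge0// ltW.
  have qp : q ^+ k <= p ^+ k by rewrite lerXn2r ?nnegrE//; lra.
  have AC : A <= (p - r) * C.
    rewrite /C mulrDr [X in _ + X]mulrC divfK; last by rewrite gt_eqF//; lra.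
    by rewrite lerDr mulr_ge0 ?divr_ge0 ?exprn_ge0 ?(ltW p0)//; lra.
  rewrite exprS.
  have H1 := ler_wpM2l r0 (IHk Nk).
  have H2 := ler_wpM2l A0 qp.
  have H3 := ler_wpM2r pk0 AC.
  apply: (@le_trans _ _ (r * (C * p ^+ k) + (p - r) * C * p ^+ k)); first lra.
  by rewrite le_eqVlt; apply/orP; left; apply/eqP; ring.
have [C' C'0 uC'] := geometric_eventually u0 p0 uC.
by exists C', p; rewrite p0.
Qed.

End RealSequences.

(** * Inner products *)

Section InnerProduct.
Variables (K : realType) (H : completeNormedModType K).
Variables (ip : {dot H for idfun}) (ip_norm : induces_norm ip).
Implicit Types (x y z : H).

Lemma ipC x y : ip x y = ip y x.
Proof. by rewrite hermC expr0 mul1r. Qed.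

Lemma ipDl x y z : ip (x + y) z = ip x z + ip y z.
Proof. exact: linearDl. Qed.

Lemma ipDr x y z : ip x (y + z) = ip x y + ip x z.
Proof. exact: linearDr. Qed.

Lemma ipBl x y z : ip (x - y) z = ip x z - ip y z.
Proof. exact: linearBl. Qed.

Lemma ipBr x y z : ip x (y - z) = ip x y - ip x z.
Proof. exact: linearBr. Qed.

Lemma ipZr c x y : ip x (c *: y) = c * ip x y.
Proof. exact: linearZr_LR. Qed.

Lemma ipZl c x y : ip (c *: x) y = c * ip x y.
Proof. exact: linearZl_LR. Qed.

Lemma sqr_normD x y : `|x + y| ^+ 2 = `|x| ^+ 2 + 2 * ip x y + `|y| ^+ 2.
Proof. by rewrite -!ip_norm ipDl !ipDr (ipC y x); ring. Qed.

Lemma sqr_normB x y : `|x - y| ^+ 2 = `|x| ^+ 2 - 2 * ip x y + `|y| ^+ 2.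
Proof. by rewrite -!ip_norm ipBl !ipBr (ipC y x); ring. Qed.

Lemma ip_suml (I : Type) (s : seq I) (f : I -> H) y :
  ip (\sum_(e <- s) f e) y = \sum_(e <- s) ip (f e) y.
Proof. exact: linear_sumlz. Qed.

Lemma ip_sumr (I : Type) (s : seq I) (f : I -> H) x :
  ip x (\sum_(e <- s) f e) = \sum_(e <- s) ip x (f e).
Proof. exact: linear_sumr. Qed.

Lemma sqr_normZ c x : `|c *: x| ^+ 2 = c ^+ 2 * `|x| ^+ 2.
Proof. by rewrite normrZ exprMn real_normK ?num_real. Qed.

Lemma ip_le_norm x y : ip x y <= `|x| * `|y|.
Proof.
have [->|x0] := eqVneq x 0; first by rewrite linear0l normr0 mul0r.
have [->|y0] := eqVneq y 0; first by rewrite linear0r normr0 mulr0.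
have xy0 : 0 < 2 * (`|x| * `|y|) by rewrite !mulr_gt0 ?normr_gt0.
rewrite -subr_ge0 -(pmulr_rge0 _ xy0).
have := sqr_ge0 `| `|y| *: x - `|x| *: y|.
rewrite sqr_normB !sqr_normZ ipZl ipZr => /le_trans; apply.
by rewrite le_eqVlt; apply/orP; left; apply/eqP; ring.
Qed.

Lemma parallelogram x y :
  `|x + y| ^+ 2 + `|x - y| ^+ 2 = 2 * (`|x| ^+ 2 + `|y| ^+ 2).
Proof. by rewrite sqr_normD sqr_normB; ring. Qed.

End InnerProduct.

Lemma le_sqrtr (K : realType) (a t : K) :
  0 <= a -> a ^+ 2 <= t -> a <= Num.sqrt t.
Proof. by move=> a0 /ler_wsqrtr; rewrite sqrtr_sqr ger0_norm. Qed.

(** * Asymptotic centres and weak convergence *)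

Section AsymptoticCenter.
Variables (K : realType) (H : completeNormedModType K).
Variables (ip : {dot H for idfun}) (ip_norm : induces_norm ip).

(** The upper limit of [|x k - y|] along [F]. A filter [F] finer than [\oo] plays
the role of a subsequence of [x]. *)
Definition asym_radius (F : set_system nat) (x : nat -> H) (y : H) : K :=
  inf [set a | \forall k \near F, `|x k - y| <= a].

Definition asym_center (F : set_system nat) (x : nat -> H) (c : H) : Prop :=
  forall y, asym_radius F x c <= asym_radius F x y.

Section Radius.
Variables (x : nat -> H) (M : K) (xM : forall k, `|x k| <= M).
Variables (F : set_system nat) (FF : ProperFilter F).
Implicit Types (y z c : H).

Local Notation rad := (asym_radius F x).

Let radii_lbound y : lbound [set a | \forall k \near F, `|x k - y| <= a] 0.
Proof. by move=> a /= /filter_ex[k]; apply: le_trans. Qed.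

Let radii_neq0 y : [set a | \forall k \near F, `|x k - y| <= a] !=set0.
Proof.
exists (M + `|y|); apply: nearW => k.
by apply: le_trans (ler_normB _ _) _; rewrite lerD2r.
Qed.

Lemma asym_radius_ge0 y : 0 <= rad y.
Proof. exact: lb_le_inf. Qed.

Lemma asym_radius_le y a : (\forall k \near F, `|x k - y| <= a) -> rad y <= a.
Proof. by apply: ge_inf; exists 0; exact: radii_lbound. Qed.

Lemma near_asym_radius y a : rad y < a -> \forall k \near F, `|x k - y| <= a.
Proof.
move=> /(inf_lt (radii_neq0 y))[b yb ba].
by apply: filterS yb => k /le_trans; apply; exact: ltW.
Qed.

Lemma asym_radius_triangle y z : rad z <= rad y + `|y - z|.
Proof.
apply/ler_addgt0Pr => e e0; apply: asym_radius_le.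
have : \forall k \near F, `|x k - y| <= rad y + e.
  by apply: near_asym_radius; rewrite ltrDl.
apply: filterS => k xky; apply: le_trans (ler_distD y _ _) _.
by rewrite addrAC lerD2r.
Qed.

(** By the parallelogram identity, at the points [x k] that are within [b] of both
[y] and [z] the squared distance to the midpoint is at most
[b^2 - |y - z|^2 / 4], and the radius of the midpoint is at least [m]. *)
Lemma asym_radius_midpoint m b y z : 0 <= m -> (forall c, m <= rad c) ->
  rad y < b -> rad z < b -> `|y - z| ^+ 2 <= 4 * (b ^+ 2 - m ^+ 2).
Proof.
move=> m0 le_m /near_asym_radius yb /near_asym_radius zb.
set c := 2^-1 *: (y + z); set t := b ^+ 2 - `|y - z| ^+ 2 / 4.
have xc : \forall k \near F, `|x k - c| ^+ 2 <= t.
  near=> k.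
  have b0 : 0 <= b by apply: (@le_trans _ _ `|x k - y|) => //; near: k.
  have ky : `|x k - y| ^+ 2 <= b ^+ 2.
    by rewrite lerXn2r ?nnegrE//; near: k.
  have kz : `|x k - z| ^+ 2 <= b ^+ 2.
    by rewrite lerXn2r ?nnegrE//; near: k.
  have := parallelogram ip_norm (x k - y) (x k - z).
  have -> : x k - y + (x k - z) = 2 *: (x k - c).
    rewrite /c scalerBr scalerA mulfV ?pnatr_eq0// scale1r opprD.
    by rewrite scaler_nat mulr2n addrACA.
  have -> : x k - y - (x k - z) = z - y.
    by rewrite opprB addrC addrA subrK.
  rewrite sqr_normZ (distrC z y) /t; lra.
have t0 : 0 <= t by have [k] := filter_ex xc; apply: le_trans; exact: sqr_ge0.
have : m <= Num.sqrt t.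
  apply: le_trans (le_m c) _; apply: asym_radius_le.
  by apply: filterS xc => k; exact: le_sqrtr.
rewrite -(@ler_pXn2r _ 2%N) ?nnegrE ?sqrtr_ge0// sqr_sqrtr// /t; lra.
Unshelve. all: by end_near. Qed.

(** The strong convexity behind both existence and uniqueness of the centre: the
sets of almost minimizers of the radius have arbitrarily small diameter. *)
Lemma asym_radius_almost_min m e : 0 <= m -> (forall c, m <= rad c) -> 0 < e ->
  exists2 d, 0 < d &
    forall y z, rad y < m + d -> rad z < m + d -> `|y - z| < e.
Proof.
move=> m0 le_m e0; pose d := Num.min 1 (e ^+ 2 / (8 * (m + 1))).
have e20 : 0 < e ^+ 2 by rewrite exprn_gt0.
have d0 : 0 < d by rewrite lt_min ltr01/= divr_gt0//; lra.
exists d => // y z yd zd.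
have d1 : d <= 1 by rewrite ge_min lexx.
have de : d * (8 * (m + 1)) <= e ^+ 2.
  by rewrite -ler_pdivlMr; [rewrite ge_min lexx orbT|lra].
rewrite -(@ltr_pXn2r _ 2%N) ?nnegrE// ?(ltW e0)//.
apply: le_lt_trans (asym_radius_midpoint m0 le_m yd zd) _.
apply: (@le_lt_trans _ _ (4 * (d * (2 * m + 1)))).
  rewrite (_ : (m + d) ^+ 2 - m ^+ 2 = d * (2 * m + d)); last by ring.
  by rewrite ler_wpM2l// ler_wpM2l ?(ltW d0)// lerD2l.
have := mulr_ge0 (ltW d0) m0; lra.
Qed.

(** A minimizing sequence is Cauchy, and the radius is 1-Lipschitz. *)
Lemma asym_center_exists : exists c, asym_center F x c.
Proof.
pose m := inf (range rad).
have rad_lb : has_lbound (range rad).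
  by exists 0 => _ [y _ <-]; exact: asym_radius_ge0.
have m0 : 0 <= m.
  apply: lb_le_inf; first by exists (rad 0); exists 0.
  by move=> _ [y _ <-]; exact: asym_radius_ge0.
have le_m y : m <= rad y by apply: ge_inf => //; exists y.
have ex_y n : exists y, rad y < m + n.+1%:R^-1.
  have : inf (range rad) < m + n.+1%:R^-1 by rewrite ltrDl invr_gt0.
  by move=> /inf_lt[|_ [y _ <-] yn]; [exists (rad 0); exists 0|exists y].
have [y yn] := choice ex_y.
have y_near d : 0 < d -> \forall n \near \oo, rad (y n) < m + d.
  move=> d0; near=> n; apply: lt_trans (yn n) _; rewrite ltrD2l.
  by near: n; exact: near_infty_natSinv_lt (PosNum d0).
have /cauchy_cvg y_cvg : cauchy (y @ \oo).
  apply: cauchy_exP => e e0.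
  have [d d0 dP] := asym_radius_almost_min m0 le_m e0.
  have yd := y_near _ d0.
  have [n nd] := filter_ex yd.
  exists (y n); apply: filterS yd => k kd.
  by rewrite -ball_normE/=; exact: dP.
exists (limn y) => z; apply: le_trans (le_m z).
apply/ler_addgt0Pr => e e0.
have e20 : 0 < e / 2 by rewrite divr_gt0.
have yl : \forall n \near \oo, `|y n - limn y| < e / 2.
  by move/cvgrPdistC_lt : y_cvg; apply.
have [n [yln ryn]] := filter_ex (filterI yl (y_near _ e20)).
apply: le_trans (asym_radius_triangle (y n) _) _; lra.
Unshelve. all: by end_near. Qed.

Lemma asym_center_unique c z : asym_center F x c -> rad z <= rad c -> z = c.
Proof.
move=> cP zc; apply/eqP; rewrite -subr_eq0 -normr_le0.
apply/ler_addgt0Pr => e e0; rewrite add0r.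
have [d d0 dP] := asym_radius_almost_min (asym_radius_ge0 c) cP e0.
by apply/ltW/dP; [apply: le_lt_trans zc _|]; rewrite ltrDl.
Qed.

(** Since [T] is nonexpansive and [x k - T (x k)] vanishes, the radius of [T c] is
at most that of [c]; the centre being unique, [T c = c]. *)
Lemma asym_center_fixed T c : nonexpansive T ->
  residual T (x k) @[k --> F] --> (0 : H) -> asym_center F x c -> fixset T c.
Proof.
move=> neT xT0 cP; apply: (asym_center_unique cP).
apply/ler_addgt0Pr => e e0; apply: asym_radius_le.
have e20 : 0 < e / 2 by rewrite divr_gt0.
have xTe : \forall k \near F, `|residual T (x k)| < e / 2.
  move/cvgrPdistC_lt/(_ _ e20) : xT0.
  by apply: filterS => k; rewrite subr0.
have xc : \forall k \near F, `|x k - c| <= rad c + e / 2.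
  by apply: near_asym_radius; rewrite ltrDl.
apply: filterS2 xTe xc => k xTe xc.
apply: le_trans (ler_distD (T (x k)) _ _) _.
by move: (neT (x k) c) xTe; rewrite /residual; lra.
Qed.

End Radius.

(** The centre [c] of the whole sequence is a fixed point, and so is the centre
[c'] along any finer filter [F]. The distances to fixed points converge, so
their limits do not depend on the filter, and comparing [c] with [c'] shows
that they agree. If [ip (x k - c) v >= e] held along such an [F], then moving
from [c] to [c + t *: v] with a small [t > 0] would lower the radius along
[F], which [c] minimizes. This replaces the extraction of weakly convergent
subsequences. *)
Lemma opial (T : H -> H) (x : nat -> H) (M : K) :
    nonexpansive T -> (forall k, `|x k| <= M) ->
    residual T (x k) @[k --> \oo] --> (0 : H) ->
    (forall z, fixset T z -> cvgn (fun k => `|x k - z|)) ->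
  exists2 c, fixset T c & weakly_cvg ip x c.
Proof.
move=> neT xM xT0 cvg_fix.
have [c cP] := asym_center_exists xM eventually_filter.
have Tc : fixset T c := asym_center_fixed xM eventually_filter neT xT0 cP.
exists c => //.
have radE (F : set_system nat) z : ProperFilter F -> F --> \oo ->
    fixset T z -> asym_radius F x z = limn (fun k => `|x k - z|).
  move=> FF Foo Tz; set l := limn _.
  have xl e : 0 < e -> \forall k \near F, l - e <= `|x k - z| <= l + e.
    move=> e0; have /cvgrPdist_le/(_ _ e0) := cvg_fix z Tz.
    by move=> /Foo; apply: filterS => k; rewrite ler_distlC.
  apply/le_anti/andP; split; apply/ler_addgt0Pr => e e0.
    by apply: asym_radius_le; apply: filterS (xl _ e0) => k /andP[].
  rewrite -lerBlDr; apply: lb_le_inf.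
    by exists (l + e); apply: filterS (xl _ e0) => k /andP[].
  move=> a /= ax; have [k [/andP[+ _] +]] := filter_ex (filterI (xl _ e0) ax).
  exact: le_trans.
have cP_sub (F : set_system nat) : ProperFilter F -> F --> \oo ->
    asym_center F x c.
  move=> FF Foo; have [c' c'P] := asym_center_exists xM FF.
  have Tc' : fixset T c'.
    by apply: (asym_center_fixed xM FF neT _ c'P); apply: cvg_trans xT0; apply: cvg_app.
  rewrite (_ : c = c')//; apply: (asym_center_unique xM FF c'P).
  have := cP c'; rewrite (radE \oo c)//. by rewrite (radE \oo c')// !(radE F).
have small v e : 0 < e -> \forall k \near \oo, ip (x k - c) v < e.
  move=> e0; apply: contrapT => not_small.
  have v0 : v != 0.
    apply/eqP => v0; apply: not_small; apply: nearW => k.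
    by rewrite v0 linear0r.
  pose F : set_system nat := within [set k | ~ ip (x k - c) v < e] \oo.
  have FF : ProperFilter F.
    apply: Build_ProperFilter_ex => A FA; apply: contrapT => A0.
    apply: not_small; have : \forall k \near \oo, ~ ip (x k - c) v < e -> A k by [].
    apply: filterS => k kA; apply: contrapT => ke.
    by apply: A0; exists k; exact: kA.
  have Foo : F --> \oo by exact: cvg_within.
  have Fe : \forall k \near F, e <= ip (x k - c) v.
    by near=> k; rewrite leNgt; apply/negP; near: k; exact: withinT.
  set l := asym_radius F x c.
  have l0 : 0 <= l by exact: (asym_radius_ge0 xM).
  have v20 : 0 < `|v| ^+ 2 by rewrite exprn_gt0// normr_gt0.
  (* [t] minimizes [- 2 t e + t^2 |v|^2], with minimum [- p]. *)
  pose t := e / `|v| ^+ 2; pose p := e ^+ 2 / `|v| ^+ 2.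
  have p0 : 0 < p by rewrite divr_gt0// exprn_gt0.
  pose b := Num.sqrt (l ^+ 2 + p / 2).
  have b2 : b ^+ 2 = l ^+ 2 + p / 2 by rewrite sqr_sqrtr// addr_ge0 ?sqr_ge0; lra.
  have lb : l < b.
    by rewrite -(@ltr_pXn2r _ 2%N) ?nnegrE ?sqrtr_ge0// b2; lra.
  have near_b : \forall k \near F, `|x k - (c + t *: v)| ^+ 2 <= b ^+ 2 - p.
    near=> k.
    have kb : `|x k - c| ^+ 2 <= b ^+ 2.
      by rewrite lerXn2r ?nnegrE ?sqrtr_ge0//; near: k; exact: near_asym_radius.
    have ke : e <= ip (x k - c) v by near: k.
    rewrite opprD addrA (sqr_normB ip_norm) sqr_normZ ipZr.
    have -> : t ^+ 2 * `|v| ^+ 2 = p.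
      by rewrite /t /p; field; rewrite normr_eq0.
    have : t * e <= t * ip (x k - c) v by rewrite ler_wpM2l// divr_ge0// ltW.
    have -> : t * e = p by rewrite /t /p expr2 mulrAC.
    lra.
  have bp0 : 0 <= b ^+ 2 - p.
    by have [k] := filter_ex near_b; apply: le_trans; exact: sqr_ge0.
  have : l <= Num.sqrt (b ^+ 2 - p).
    apply: le_trans (cP_sub F FF Foo (c + t *: v)) _.
    apply: (asym_radius_le FF).
    by apply: filterS near_b => k; exact: le_sqrtr.
  rewrite -(@ler_pXn2r _ 2%N) ?nnegrE ?sqrtr_ge0// sqr_sqrtr// b2; lra.
move=> v; apply/cvgrPdistC_lt => e e0.
apply: filterS2 (small v e e0) (small (- v) e e0) => k.
rewrite linearNr -ipBl => ke keN; rewrite ltr_norml; lra.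
Unshelve. all: by end_near. Qed.

End AsymptoticCenter.

(** * Weak and strong convergence in finite dimension *)

Section FiniteDimension.
Variables (K : realType) (H : completeNormedModType K).
Variables (ip : {dot H for idfun}) (ip_norm : induces_norm ip).

(** Gram-Schmidt. Only the fact that [P v := \sum_(e <- s) ip v e *: e] fixes the
vectors of [bs] and of [s] is recorded: [P] is self-adjoint, so [b - P b] is
orthogonal to every vector that [P] fixes, and appending its normalization to
[s] extends the property to [b]. *)
Lemma finite_dim_projection (bs : seq H) : exists s : seq H,
  forall b, b \in bs ++ s -> \sum_(e <- s) ip b e *: e = b.
Proof.
elim: bs => [|b bs [s sP]]; first by exists [::].
pose P v := \sum_(e <- s) ip v e *: e.
have PC v v' : ip (P v) v' = ip v (P v').
  by rewrite /P ip_suml ip_sumr; apply: eq_bigr => e _; rewrite ipZl ipZr mulrC (ipC ip e).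
pose u := b - P b.
have u_orth v : P v = v -> ip u v = 0.
  by move=> Pv; rewrite ipBl PC Pv subrr.
have [u0|u0] := eqVneq u 0.
  exists s => v; rewrite cat_cons inE => /predU1P[->|]; last exact: sP.
  by apply/esym/eqP; rewrite -subr_eq0; exact/eqP.
pose n := `|u|^-1; pose s' := n *: u :: s.
have nu : n ^+ 2 * `|u| ^+ 2 = 1.
  by rewrite -exprMn mulVf ?normr_eq0// expr1n.
have uP v : v \in bs ++ s -> ip u v = 0 by move=> /sP; exact: u_orth.
have Pu : P u = 0.
  rewrite /P big1_seq// => e /andP[_ es].
  by rewrite uP ?scale0r// mem_cat es orbT.
have s'P v : \sum_(e <- s') ip v e *: e = (n ^+ 2 * ip v u) *: u + P v.
  by rewrite big_cons ipZr scalerA mulrAC -expr2.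
exists s' => v; rewrite s'P.
have old w : w \in bs ++ s -> (n ^+ 2 * ip w u) *: u + P w = w.
  by move=> ws; rewrite ipC uP// mulr0 scale0r add0r; exact: sP.
rewrite cat_cons inE mem_cat inE => /or4P[/eqP->|vbs|/eqP->|vs].
- have -> : ip b u = `|u| ^+ 2.
    by rewrite -{1}(subrK (P b) b) ipDl PC Pu linear0r addr0 ip_norm.
  by rewrite nu scale1r subrK.
- by apply: old; rewrite mem_cat vbs.
- rewrite ipZl ip_norm.
  have -> : P (n *: u) = 0.
    rewrite -(scaler0 _ n) -Pu /P scaler_sumr.
    by apply: eq_bigr => e _; rewrite ipZl scalerA.
  by rewrite addr0 mulrCA nu mulr1.
- by apply: old; rewrite mem_cat vs orbT.
Qed.

(** The squared norm is a finite sum of squares of coordinates [ip v e], each of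
which tends to zero by weak convergence. *)
Lemma finite_dim_weak_strong (x : nat -> H) (c : H) :
  finite_dimensional H -> weakly_cvg ip x c -> x k @[k --> \oo] --> c.
Proof.
move=> [n [b b_span]] xc.
have [s sP] := finite_dim_projection [seq b i | i <- enum 'I_n].
have sumE v : \sum_(e <- s) ip v e *: e = v.
  have [a ->] := b_span v.
  under eq_bigr => e _.
    rewrite (_ : ip _ _ = \sum_(i < n) a i * ip (b i) e); last first.
      by rewrite ip_suml; apply: eq_bigr => i _; rewrite ipZl.
    rewrite scaler_suml; over.
  rewrite exchange_big; apply: eq_bigr => i _.
  under eq_bigr do rewrite -scalerA.
  rewrite -scaler_sumr sP// mem_cat; apply/orP; left.
  by apply/mapP; exists i; rewrite ?mem_enum.
have normE v : `|v| ^+ 2 = \sum_(e <- s) ip v e ^+ 2.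
  rewrite -ip_norm -{2}(sumE v) ip_sumr.
  by apply: eq_bigr => e _; rewrite ipZr expr2.
have ip0 e : ip (x k - c) e @[k --> \oo] --> (0 : K).
  rewrite -(subrr (ip c e)); under eq_fun do rewrite ipBl.
  by apply: cvgB; [exact: xc|exact: cvg_cst].
have : `|x k - c| ^+ 2 @[k --> \oo] --> (0 : K).
  under eq_fun do rewrite normE.
  elim: (s) => [|e s' IHs].
    by under eq_fun do rewrite big_nil; exact: cvg_cst.
  under eq_fun do rewrite big_cons expr2.
  have := cvgD (cvgM (ip0 e) (ip0 e)) IHs.
  by rewrite mulr0 addr0; exact.
move=> xc2; apply/cvgrPdistC_lt => e e0.
have e20 : 0 < e ^+ 2 by rewrite exprn_gt0.
move/cvgrPdistC_lt/(_ _ e20) : xc2; apply: filterS => k.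
rewrite subr0 ger0_norm ?sqr_ge0//.
by rewrite ltr_pXn2r ?nnegrE ?(ltW e0).
Qed.

End FiniteDimension.

(** * Residuals of averaged operators *)

Section AveragedOperators.
Variables (K : realType) (H : completeNormedModType K).
Variables (ip : {dot H for idfun}) (ip_norm : induces_norm ip).
Variables (T : H -> H) (alpha : K).
Hypotheses (alpha01 : 0 < alpha <= 1) (T_averaged : averaged alpha T).
Implicit Types (x y z w d : H).

Local Notation Rs := (residual T).

Lemma averaged_nonexpansive : nonexpansive T.
Proof.
case: T_averaged => S [neS TE] x y; have /andP[a0 a1] := alpha01.
have -> : T x - T y = (1 - alpha) *: (x - y) + alpha *: (S x - S y).
  by rewrite !TE !scalerBr opprD addrACA.
apply: le_trans (ler_normD _ _) _.
rewrite !normrZ !ger0_norm ?(ltW a0) ?subr_ge0//.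
have := ler_wpM2l (ltW a0) (neS x y); lra.
Qed.

(** Expand [|S x - S y|^2 <= |x - y|^2], where [S = id - alpha^-1 R]. *)
Lemma residual_cocoercive x y :
  `|Rs x - Rs y| ^+ 2 <= 2 * alpha * ip (Rs x - Rs y) (x - y).
Proof.
case: T_averaged => S [neS TE]; have /andP[a0 a1] := alpha01.
have RE u : Rs u = alpha *: (u - S u).
  by rewrite /residual TE scalerBl scale1r scalerBr opprD opprB addrA addrCA subrr addr0.
have SE : S x - S y = x - y - alpha^-1 *: (Rs x - Rs y).
  rewrite !RE -scalerBr scalerA mulVf ?gt_eqF// scale1r.
  have -> : x - S x - (y - S y) = (x - y) - (S x - S y).
    by rewrite !opprB addrACA [RHS]addrACA [- S x - y]addrC.
  by rewrite subKr.
have : `|S x - S y| ^+ 2 <= `|x - y| ^+ 2 by rewrite lerXn2r ?nnegrE.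
rewrite SE (sqr_normB ip_norm) sqr_normZ ipZr (ipC _ (Rs x - Rs y)).
set n := `|Rs x - Rs y| ^+ 2; set p := ip _ _ => le_np.
have : alpha^-1 ^+ 2 * n <= 2 * (alpha^-1 * p) by lra.
rewrite -(@ler_pM2l _ (alpha ^+ 2)) ?exprn_gt0//.
have -> : alpha ^+ 2 * (alpha^-1 ^+ 2 * n) = n.
  by rewrite mulrA -exprMn mulfV ?gt_eqF// expr1n mul1r.
suff -> : alpha ^+ 2 * (2 * (alpha^-1 * p)) = 2 * alpha * p by [].
by field; rewrite gt_eqF.
Qed.

Lemma residual_lipschitz x y : `|Rs x - Rs y| <= 2 * alpha * `|x - y|.
Proof.
have /andP[a0 a1] := alpha01.
have [->|n0] := eqVneq (Rs x - Rs y) 0; first by rewrite normr0 !mulr_ge0 // ltW.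
rewrite -(@ler_pM2l _ `|Rs x - Rs y|) ?normr_gt0// -expr2.
apply: le_trans (residual_cocoercive x y) _; rewrite mulrCA ler_wpM2l//.
  by rewrite mulr_ge0 // ltW.
exact: ip_le_norm.
Qed.

Lemma residual_fix z : fixset T z -> Rs z = 0.
Proof. by rewrite /residual => ->; rewrite subrr. Qed.

Lemma residual_le_dist_fix x z : fixset T z -> `|Rs x| <= 2 * alpha * `|x - z|.
Proof.
by move=> /residual_fix Rz; rewrite -(subr0 (Rs x)) -Rz residual_lipschitz.
Qed.

Lemma zer_residual : zer Rs = fixset T.
Proof.
apply/seteqP; split=> z /=; last exact: residual_fix.
by move/eqP; rewrite subr_eq0 => /eqP.
Qed.

(** Cocoercivity at the pair [w], [z]: the half-space
[{z | rho x w <= 2 alpha ip (R w) (x - z)}] contains all fixed points, and a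
safeguarded iterate is a relaxed projection of [x] onto it. *)
Lemma rho_le_fix x w z : fixset T z -> rho ip T alpha x w <= 2 * alpha * ip (Rs w) (x - z).
Proof.
move=> /residual_fix Rz; have := residual_cocoercive w z.
rewrite Rz subr0 /rho => coco.
have -> : x - z = (w - z) - (w - x) by rewrite opprB [RHS]addrC addrA subrK.
rewrite ipBr; lra.
Qed.

Lemma rho_ge x w :
  `|Rs w| * (`|Rs w| - 2 * alpha * `|w - x|) <= rho ip T alpha x w.
Proof.
have /andP[a0 _] := alpha01; rewrite /rho mulrBr -expr2 lerD2l lerN2 mulrCA.
by apply: ler_wpM2l; [rewrite mulr_ge0// ltW|exact: ip_le_norm].
Qed.

Lemma rho_le x w :
  rho ip T alpha x w <= `|Rs w| * (`|Rs w| + 2 * alpha * `|w - x|).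
Proof.
have /andP[a0 _] := alpha01; rewrite /rho mulrDr -expr2 lerD2l -mulrN.
rewrite -linearNl -normrN mulrCA normrN -[X in _ <= _ * (X * _)]normrN.
by apply: ler_wpM2l; [rewrite mulr_ge0// ltW|exact: ip_le_norm].
Qed.

(** Both defects, [|R x| - |R w|] and [2 alpha |w - x|], are at most
[2 alpha D tau |R x|]; this is where the factor [4 alpha D] of the stepsize bound
comes from. *)
Lemma short_step_safeguard (sigma D tau : K) x d : 0 <= tau ->
    `|d| <= D * `|Rs x| -> 4 * alpha * D * tau <= 1 - sigma ->
  safeguard ip T alpha sigma x (x + tau *: d).
Proof.
move=> tau0 dD tauD; rewrite /safeguard; set w := x + _.
have /andP[a0 _] := alpha01.
have wx : `|w - x| <= tau * D * `|Rs x|.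
  rewrite /w addrC addKr normrZ ger0_norm// -mulrA.
  exact: ler_wpM2l.
apply: le_trans (rho_ge x w); rewrite mulrAC mulrC ler_wpM2l//.
have Rw : `|Rs x| <= `|Rs w| + 2 * alpha * `|w - x|.
  have := ler_distD (Rs w) (Rs x) 0; rewrite !subr0 distrC => /le_trans; apply.
  by rewrite addrC lerD2l residual_lipschitz.
have := ler_wpM2l (ltW a0) wx.
have := ler_wpM2r (normr_ge0 (Rs x)) tauD; lra.
Qed.

Section SafeguardStep.
Variables (lambda sigma : K) (x w : H).
Hypotheses (lambda01 : 0 < lambda < alpha^-1) (sigma0 : 0 < sigma).
Hypotheses (Rw0 : Rs w != 0) (safe : safeguard ip T alpha sigma x w).

Let x' := x - (lambda * (rho ip T alpha x w / `|Rs w| ^+ 2)) *: Rs w.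

(** The relaxed projection gains [lambda (alpha^-1 - lambda) (rho / |R w|)^2], and
the line search test bounds [rho / |R w|] below by [sigma |R x|]. *)
Lemma safeguard_step_fejer z : fixset T z ->
  `|x' - z| ^+ 2 <=
  `|x - z| ^+ 2 - lambda * (alpha^-1 - lambda) * sigma ^+ 2 * `|Rs x| ^+ 2.
Proof.
move=> Tz; have /andP[l0 la] := lambda01; have /andP[a0 _] := alpha01.
have := rho_le_fix x w Tz; have := safe; rewrite /safeguard.
set r := rho _ _ _ _ _; set v := `|Rs w|; set u := `|Rs x| => safe_r r_le.
have v0 : 0 < v by rewrite normr_gt0.
have vu0 : 0 <= sigma * v * u by rewrite !mulr_ge0 ?(ltW sigma0) ?normr_ge0.
have r0 : 0 <= r by exact: le_trans safe_r.
set g := lambda * (r / v ^+ 2).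
have g0 : 0 <= g by rewrite mulr_ge0 ?(ltW l0)// divr_ge0// exprn_ge0// ltW.
have -> : x' - z = (x - z) - g *: Rs w by rewrite /x' addrAC.
rewrite (sqr_normB ip_norm) ipZr sqr_normZ -/v (ipC _ (x - z)).
set p := ip (Rs w) (x - z) in r_le *.
have gp : g * r <= g * (2 * alpha * p) by rewrite ler_wpM2l.
have gp' : alpha^-1 * (g * r) <= 2 * (g * p).
  rewrite -(@ler_pM2l _ alpha)// mulVKf ?gt_eqF//; lra.
have ru : sigma ^+ 2 * u ^+ 2 <= r ^+ 2 / v ^+ 2.
  rewrite ler_pdivlMr ?exprn_gt0//.
  have -> : sigma ^+ 2 * u ^+ 2 * v ^+ 2 = (sigma * v * u) ^+ 2 by ring.
  by rewrite lerXn2r ?nnegrE.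
have gE : g * r = lambda * (r ^+ 2 / v ^+ 2).
  by rewrite /g; field; rewrite gt_eqF.
have g2E : g ^+ 2 * v ^+ 2 = lambda ^+ 2 * (r ^+ 2 / v ^+ 2).
  by rewrite /g; field; rewrite gt_eqF.
have l1 : 0 <= lambda * (alpha^-1 - lambda).
  by rewrite mulr_ge0 ?(ltW l0)// subr_ge0 ltW.
have := ler_wpM2l l1 ru; rewrite gE in gp'; rewrite g2E.
lra.
Qed.

Lemma safeguard_step_length :
  `|x' - x| <= lambda * (`|Rs w| + 2 * alpha * `|w - x|).
Proof.
have /andP[l0 la] := lambda01.
have v0 : 0 < `|Rs w| by rewrite normr_gt0.
have r0 : 0 <= rho ip T alpha x w.
  by apply: le_trans safe; rewrite !mulr_ge0 ?(ltW sigma0).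
have -> : x' - x = - ((lambda * (rho ip T alpha x w / `|Rs w| ^+ 2)) *: Rs w).
  by rewrite /x' addrC addKr.
rewrite normrN normrZ ger0_norm; last first.
  by rewrite mulr_ge0 ?(ltW l0)// divr_ge0// exprn_ge0.
rewrite -[leLHS]mulrA ler_wpM2l ?(ltW l0)//.
rewrite expr2 invfM mulrA mulfVK ?gt_eqF// ler_pdivrMr// mulrC.
exact: rho_le.
Qed.

End SafeguardStep.
End AveragedOperators.

(** * The line search and the three kinds of steps *)

(** What the convergence proof needs to know about one iteration: [x], [eta], [s]
are the values at entry (iterate, blind-update threshold, safe level), primes
mark those at exit, and [r] is the residual norm at [x]. Only the last case
gives a Fejer decrease; the first two give a decrease of [eta] or [s]. *)
Variant step_kind (K : realType) (H : completeNormedModType K) (S : set H)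
    (c0 c1 D G c Q : K) (x x' : H) (r eta eta' s s' : K) : Prop :=
| BlindStep of r <= c0 * eta & eta' = r & s' = s & `|x' - x| <= D * r
| EducatedStep of c0 * eta < r & eta' = eta & r <= s & 0 <= s' <= c1 * r + Q
    & `|x' - x| <= D * r
| SafeguardStep of c0 * eta < r & eta' = eta & s' = s
    & (forall z, S z -> `|x' - z| ^+ 2 <= `|x - z| ^+ 2 - c * r ^+ 2)
    & `|x' - x| <= G * r.

Section Scheme.
Variables (K : realType) (H : completeNormedModType K).
Variables (ip : {dot H for idfun}) (ip_norm : induces_norm ip).
Variables (T : H -> H) (alpha : K).
Hypotheses (alpha01 : 0 < alpha <= 1) (T_averaged : averaged alpha T).
Variables (c0 c1 q beta sigma lambda D : K).
Hypotheses (q01 : 0 <= q < 1) (beta01 : 0 < beta < 1) (sigma01 : 0 < sigma < 1).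
Hypotheses (lambda01 : 0 < lambda < alpha^-1) (D0 : 0 <= D).

Local Notation Rs := (residual T).
Local Notation accepted := (accepted ip T alpha c1 sigma).
Local Notation stops_at := (stops_at ip T alpha c1 beta sigma).

Lemma short_trial_accepted (x d : H) rsafe m : `|d| <= D * `|Rs x| ->
  4 * alpha * D * beta ^+ m <= 1 - sigma -> accepted x rsafe (trial beta x d m).
Proof.
have /andP[b0 _] := beta01 => dD bm; rewrite /Defs.accepted /trial.
rewrite (short_step_safeguard ip_norm alpha01 T_averaged _ dD bm) ?orbT//.
by rewrite exprn_ge0// ltW.
Qed.

(** The stepsizes [beta ^+ m] tend to zero, and a short step passes the safeguard test. *)
Lemma line_search_terminates (x d : H) rsafe : `|d| <= D * `|Rs x| ->
  exists m, stops_at x rsafe d m.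
Proof.
move=> dD; have /andP[b0 b1] := beta01; have /andP[s0 s1] := sigma01.
have /andP[a0 _] := alpha01.
have aD0 : 0 <= 4 * alpha * D by rewrite !mulr_ge0// ltW.
pose e := (1 - sigma) / (4 * alpha * D + 1).
have e0 : 0 < e by rewrite divr_gt0//; lra.
have [m bm] : exists m, beta ^+ m < e.
  have /cvgrPdistC_lt/(_ _ e0) : (GRing.exp beta : nat -> K) @ \oo --> (0 : K).
    by apply: cvg_expr; rewrite gtr0_norm.
  move=> /filter_ex[m]; rewrite subr0 ger0_norm ?exprn_ge0 ?(ltW b0)//.
  by exists m.
have acc : exists m, accepted x rsafe (trial beta x d m).
  exists m; apply: short_trial_accepted => //.
  apply: le_trans (ler_wpM2l aD0 (ltW bm)) _.
  by rewrite /e mulrA ler_pdivrMr; [nra|lra].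
have [n n_acc n_min] := ex_minnP acc; exists n; split=> // j jn.
by apply/negP => /n_min; rewrite leqNgt jn.
Qed.

Lemma stops_at_dir0 (x d : H) rsafe m : stops_at x rsafe d m -> d = 0 -> m = 0%N.
Proof.
case: m => // m [rejected _] d0; have /negP[] := rejected 0%N isT.
have /andP[_ s1] := sigma01; rewrite /Defs.accepted; apply/orP; right.
apply: (@short_step_safeguard _ _ _ ip_norm _ _ alpha01 T_averaged _ 0).
- by rewrite expr0.
- by rewrite d0 normr0 mul0r.
- by rewrite mulr0 mul0r subr_ge0 ltW.
Qed.

(** When a candidate after the first is accepted, the previous stepsize was too
long for [short_trial_accepted]. *)
Lemma stops_at_stepsize (x d : H) rsafe m : `|d| <= D * `|Rs x| -> d <> 0 ->
    stops_at x rsafe d m ->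
  Num.min (beta * ((1 - sigma) / (4 * alpha * D))) 1 <= beta ^+ m.
Proof.
move=> dD d0; have /andP[b0 b1] := beta01; have /andP[a0 _] := alpha01.
have D_gt0 : 0 < D.
  rewrite lt0r D0 andbT; apply: contra_notN d0 => /eqP D_eq0.
  by move: dD; rewrite D_eq0 mul0r normr_le0 => /eqP.
case: m => [|m] [rejected _]; first by rewrite ge_min expr0 lexx orbT.
have : ~ 4 * alpha * D * beta ^+ m <= 1 - sigma.
  by move=> /(short_trial_accepted rsafe dD); apply/negP/rejected.
move=> /negP; rewrite -ltNge => bm.
rewrite ge_min exprS ler_pM2l// ler_pdivrMr ?mulr_gt0// mulrC.
by rewrite (ltW bm).
Qed.

Variables (x d w : nat -> H) (eta rsafe tau : nat -> K).
Hypothesis sm :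
  superMann ip T alpha c0 c1 q beta sigma lambda x d w eta rsafe tau.
Hypothesis nosol : no_finite_solution ip T alpha c0 c1 beta sigma x d eta rsafe.
Hypothesis d_le : forall k, `|d k| <= D * `|Rs (x k)|.

Local Notation blind := (blind T c0 x eta).

Lemma supermann_stepsize0 k : d k = 0 -> tau k = 1.
Proof.
move=> dk0; have [bk|nbk] := pselect (blind k).
  by have [] := sm_blind sm bk.
have [m mstop] := line_search_terminates (rsafe k) (d_le k).
by have [-> _] := sm_search sm nbk mstop; rewrite (stops_at_dir0 mstop dk0).
Qed.

Lemma supermann_stepsize k : d k <> 0 ->
  Num.min (beta * ((1 - sigma) / (4 * alpha * D))) 1 <= tau k.
Proof.
move=> dk0; have [bk|nbk] := pselect (blind k).
  by have [_ _ ->] := sm_blind sm bk; rewrite ge_min lexx orbT.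
have [m mstop] := line_search_terminates (rsafe k) (d_le k).
have [-> _] := sm_search sm nbk mstop.
exact: stops_at_stepsize (d_le k) dk0 mstop.
Qed.

Lemma supermann_step k :
  step_kind (fixset T) c0 c1 D (lambda * (1 + 4 * alpha * D))
    (lambda * (alpha^-1 - lambda) * sigma ^+ 2) (q ^+ k)
    (x k) (x k.+1) `|Rs (x k)| (eta k) (eta k.+1) (rsafe k) (rsafe k.+1).
Proof.
have [bk|nbk] := pselect (blind k).
  have [etaE rsE _ wE xE] := sm_blind sm bk.
  by apply: BlindStep => //; rewrite xE wE addrC addKr.
have /andP[b0 b1] := beta01; have /andP[s0 s1] := sigma01.
have /andP[a0 _] := alpha01; have /andP[l0 _] := lambda01.
have [m mstop] := line_search_terminates (rsafe k) (d_le k).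
have [tauE wE] := sm_search sm nbk mstop.
have etaE := sm_eta sm nbk.
have r_gt : c0 * eta k < `|Rs (x k)| by rewrite ltNge; exact/negP.
have wtrial : w k = trial beta (x k) (d k) m by rewrite wE tauE.
have wx : `|w k - x k| <= D * `|Rs (x k)|.
  apply: le_trans (d_le k).
  rewrite wE tauE addrC addKr normrZ ger0_norm ?exprn_ge0 ?(ltW b0)//.
  by rewrite ler_piMl// exprn_ile1// ltW.
have [edu|nedu] := boolP (educated T c1 (x k) (rsafe k) (w k)).
  have [xE rsE] := sm_educated sm nbk mstop edu.
  have /andP[r_le Rw_le] := edu.
  apply: EducatedStep => //; last by rewrite xE.
  by rewrite rsE lerD2r Rw_le andbT addr_ge0// exprn_ge0//; case/andP: q01.
have [xE rsE] := sm_safeguard sm nbk mstop nedu.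
have Rw0 : Rs (w k) != 0.
  by apply/eqP; rewrite wtrial; apply: nosol.2 => //; case: mstop.
have safe : safeguard ip T alpha sigma (x k) (w k).
  by case: mstop => _; rewrite /Defs.accepted -wtrial (negPf nedu).
apply: SafeguardStep => // [z Tz|]; rewrite xE.
  exact: safeguard_step_fejer.
apply: le_trans (safeguard_step_length ip_norm alpha01 lambda01 s0 Rw0 safe) _.
rewrite -[leRHS]mulrA ler_wpM2l ?(ltW l0)//.
have := ler_distD (Rs (x k)) (Rs (w k)) 0; rewrite !subr0.
have := residual_lipschitz ip_norm alpha01 T_averaged (w k) (x k).
have := ler_wpM2l (ltW a0) wx; lra.
Qed.

End Scheme.

(** * Distance to a set *)

Section Distance.
Variables (K : realType) (H : completeNormedModType K).
Variables (S : set H) (S0 : S !=set0).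
Implicit Types (x y z : H).

Let dists_lbound x : lbound [set `|x - z| | z in S] 0.
Proof. by move=> _ [z _ <-]. Qed.

Let dists_neq0 x : [set `|x - z| | z in S] !=set0.
Proof. by have [z Sz] := S0; exists `|x - z|; exists z. Qed.

Lemma dist_ge0 x : 0 <= dist x S.
Proof. exact: lb_le_inf. Qed.

Lemma dist_le x z : S z -> dist x S <= `|x - z|.
Proof. by move=> Sz; apply: ge_inf; [exists 0|exists z]. Qed.

Lemma le_dist x a : (forall z, S z -> a <= `|x - z|) -> a <= dist x S.
Proof. by move=> ax; apply: lb_le_inf => // _ [z Sz <-]; exact: ax. Qed.

Lemma dist_triangle x y : dist y S <= dist x S + `|y - x|.
Proof.
rewrite -lerBlDr; apply: le_dist => z Sz; rewrite lerBlDr addrC.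
exact: le_trans (dist_le y Sz) (ler_distD x y z).
Qed.

(** The decrement [a] does not depend on [z], so the infimum over [z] inherits it. *)
Lemma dist_fejer x x' a : 0 <= a ->
    (forall z, S z -> `|x' - z| ^+ 2 <= `|x - z| ^+ 2 - a) ->
  dist x' S ^+ 2 <= dist x S ^+ 2 - a.
Proof.
move=> a0 fejer; rewrite lerBrDr.
have b0 : 0 <= dist x' S ^+ 2 + a by rewrite addr_ge0// sqr_ge0.
have : Num.sqrt (dist x' S ^+ 2 + a) <= dist x S.
  apply: le_dist => z Sz.
  rewrite -(@ler_pXn2r _ 2%N) ?nnegrE ?sqrtr_ge0// sqr_sqrtr// -lerBrDr.
  apply: le_trans (fejer z Sz).
  by rewrite lerXn2r ?nnegrE ?dist_ge0 ?dist_le.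
by rewrite -(@ler_pXn2r _ 2%N) ?nnegrE ?sqrtr_ge0 ?dist_ge0// sqr_sqrtr.
Qed.

End Distance.

(** * Convergence of sequences generated by the three kinds of steps *)

Section StepAnalysis.
Variables (K : realType) (H : completeNormedModType K).
Variables (S : set H) (S0 : S !=set0).
Variables (c0 c1 q D G c L : K).
Hypotheses (c0_01 : 0 <= c0 < 1) (c1_01 : 0 <= c1 < 1) (q01 : 0 <= q < 1).
Hypotheses (D0 : 0 <= D) (G0 : 0 <= G) (c_gt0 : 0 < c) (L_gt0 : 0 < L).
Variables (x : nat -> H) (r eta s : nat -> K).
Hypothesis r_gt0 : forall k, 0 < r k.
Hypothesis r_le : forall k z, S z -> r k <= L * `|x k - z|.
Hypotheses (eta0 : eta 0%N = r 0%N) (s0 : s 0%N = r 0%N).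
Hypothesis stepP : forall k, step_kind S c0 c1 D G c (q ^+ k)
  (x k) (x k.+1) (r k) (eta k) (eta k.+1) (s k) (s k.+1).

Lemma eta_gt0 k : 0 < eta k.
Proof.
by elim: k => [|k IHk]; [rewrite eta0|case: (stepP k) => [_ ->|_ ->|_ ->]].
Qed.

Lemma s_ge0 k : 0 <= s k.
Proof.
elim: k => [|k IHk]; first by rewrite s0 ltW.
by case: (stepP k) => [_ _ ->|_ _ _ /andP[]|_ _ ->].
Qed.

Lemma step_length k : `|x k.+1 - x k| <= (D + G) * r k.
Proof.
have DG : D <= D + G by rewrite lerDl.
have GD : G <= D + G by rewrite lerDr.
case: (stepP k) => _ _ _ => [|_|_] /le_trans; apply;
  by rewrite ler_wpM2r// ltW.
Qed.

(** The residual norm at the blind and educated steps that are not of Fejer type,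
and zero elsewhere. *)
Let nonfejer k : K := if `[< forall z, S z ->
  `|x k.+1 - z| ^+ 2 <= `|x k - z| ^+ 2 - c * r k ^+ 2 >] then 0 else r k.

Let nonfejer_ge0 k : 0 <= nonfejer k.
Proof. by rewrite /nonfejer; case: asboolP => // _; exact: ltW. Qed.

Let nonfejer_le k : nonfejer k <= r k.
Proof. by rewrite /nonfejer; case: asboolP => // _; exact: ltW. Qed.

(** A blind step lowers [eta] by at least [(1 - c0) r k], an educated one lowers [s]
by at least [(1 - c1) r k - q^k], and no step raises [eta], nor [s] by more than
[q^k]; so these residual norms telescope. *)
Let nonfejer_summable : cvgn (series nonfejer).
Proof.
have /andP[c00 c0_1] := c0_01; have /andP[c10 c1_1] := c1_01.
have /andP[q0 q1] := q01.
have d0 : 0 < 1 - c0 by rewrite subr_gt0.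
have d1 : 0 < 1 - c1 by rewrite subr_gt0.
pose t k := (1 - c0)^-1 * eta k + (1 - c1)^-1 * s k.
have i0 : 0 < (1 - c0)^-1 by rewrite invr_gt0.
have i1 : 0 < (1 - c1)^-1 by rewrite invr_gt0.
apply: (@cvgn_series_telescope _ _ (fun k => (1 - c1)^-1 * q ^+ k) t) => //.
- move=> k; apply: addr_ge0; apply: mulr_ge0.
  + exact: ltW.
  + exact: ltW (eta_gt0 k).
  + exact: ltW.
  + exact: s_ge0.
- move=> k; rewrite /t.
  have qk : 0 <= (1 - c1)^-1 * q ^+ k by rewrite mulr_ge0 ?(ltW i1)// exprn_ge0.
  have ek := nonfejer_le k.
  case: (stepP k) => [r_c0 -> -> _|_ -> rs /andP[_ s'_le] _|_ -> -> fejer _].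
  + have h : (1 - c0) * r k <= eta k - r k.
      have r_eta : r k <= eta k.
        by apply: le_trans r_c0 _; rewrite ler_piMl ?(ltW c0_1)// ltW// eta_gt0.
      by have := ler_wpM2l (ltW d0) r_eta; lra.
    have : r k <= (1 - c0)^-1 * (eta k - r k) by rewrite ler_pdivlMl.
    lra.
  + have h : (1 - c1) * r k <= s k - s k.+1 + q ^+ k.
      by have := ler_wpM2l c10 rs; lra.
    have : r k <= (1 - c1)^-1 * (s k - s k.+1 + q ^+ k) by rewrite ler_pdivlMl.
    lra.
  + have -> : nonfejer k = 0 by rewrite /nonfejer asboolT.
    lra.
- by apply: is_cvg_geometric_series; rewrite ger0_norm.
Qed.

Let fejer_perturbed k z : S z -> `|x k.+1 - z| <= `|x k - z| + D * nonfejer k.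
Proof.
move=> Sz.
have short : `|x k.+1 - x k| <= D * r k -> `|x k.+1 - z| <= `|x k - z| + D * r k.
  by move=> xx; apply: le_trans (ler_distD (x k) _ _) _; rewrite addrC lerD2l.
rewrite /nonfejer; case: asboolP => [fejer|not_fejer].
  rewrite mulr0 addr0 -(@ler_pXn2r _ 2%N) ?nnegrE//.
  apply: le_trans (fejer z Sz) _; rewrite lerBlDr lerDl.
  by rewrite mulr_ge0 ?(ltW c_gt0)// sqr_ge0.
by case: (stepP k) => [_ _ _|_ _ _ _|_ _ _ /not_fejer] //; exact: short.
Qed.

Lemma dist_cvg z : S z -> cvgn (fun k => `|x k - z|).
Proof.
move=> Sz; apply: (@cvgn_of_le_addsummable _ _ (fun k => D * nonfejer k)) => //.
- by move=> k; exact: fejer_perturbed.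
- exact: cvgn_series_scale nonfejer_summable.
Qed.

Lemma dist_bounded z : S z -> exists2 M, 0 <= M & forall k, `|x k - z| <= M.
Proof.
move=> /dist_cvg/cvg_seq_bounded/bounded_fun_has_ubound[M xM].
have xkM k : `|x k - z| <= M by apply: xM; exists k.
by exists M => //; exact: le_trans (xkM 0%N).
Qed.

(** Fejer steps give the decrease directly. At the others the distance grows by at
most [D * r k], and since the iterates and the residuals are bounded, every
quadratic term is at most a constant times [r k], which is summable there. *)
Lemma sqr_dist_descent z : S z -> exists b : nat -> K, [/\ forall k, 0 <= b k,
  cvgn (series b) &
  forall k, c * r k ^+ 2 <= `|x k - z| ^+ 2 - `|x k.+1 - z| ^+ 2 + b k].
Proof.
move=> Sz; have [M M0 xM] := dist_bounded Sz.
pose B := 2 * D * M + (D ^+ 2 + c) * (L * M).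
have B0 : 0 <= B.
  rewrite /B addr_ge0 ?mulr_ge0 ?(ltW L_gt0)//.
  by rewrite addr_ge0 ?sqr_ge0// ltW.
exists (fun k => B * nonfejer k); split.
- by move=> k; rewrite mulr_ge0.
- exact: cvgn_series_scale nonfejer_summable.
move=> k; have := fejer_perturbed k Sz.
rewrite /nonfejer; case: asboolP => [/(_ z Sz)|_ le_x']; first by rewrite mulr0; lra.
have rk := ltW (r_gt0 k); set u := `|x k - z| in le_x' *.
have uM : u <= M by exact: xM.
have rLM : r k <= L * M.
  by apply: le_trans (r_le k Sz) _; rewrite ler_wpM2l ?(ltW L_gt0).
have x'2 : `|x k.+1 - z| ^+ 2 <= (u + D * r k) ^+ 2.
  by rewrite lerXn2r ?nnegrE ?addr_ge0 ?mulr_ge0// normr_ge0.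
have rr : (D ^+ 2 + c) * r k ^+ 2 <= (D ^+ 2 + c) * (L * M) * r k.
  rewrite -mulrA ler_wpM2l ?addr_ge0 ?sqr_ge0 ?(ltW c_gt0)// expr2.
  exact: ler_wpM2r.
have Du : 2 * (D * r k) * u <= 2 * (D * r k) * M.
  by rewrite ler_wpM2l// !mulr_ge0.
rewrite /B; lra.
Qed.

Lemma iterates_quasi_fejer : quasi_Fejer x S.
Proof.
move=> z Sz; have [b [b0 cb xb]] := sqr_dist_descent Sz.
(* The geometric term makes the perturbations positive. *)
exists (fun k => b k + 2^-1 ^+ k); split.
- by move=> k; rewrite ltr_wpDl// exprn_gt0.
- apply: cvgn_series_add => //.
  rewrite exprn_geometric; apply: is_cvg_geometric_series.
  by rewrite ger0_norm//; lra.
- move=> k; have := xb k.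
  have := mulr_ge0 (ltW c_gt0) (sqr_ge0 (r k)).
  have : 0 <= (2^-1 : K) ^+ k by rewrite exprn_ge0.
  lra.
Qed.

Lemma sqr_residual_summable : cvgn (series (fun k => r k ^+ 2)).
Proof.
have [z Sz] := S0; have [b [b0 cb xb]] := sqr_dist_descent Sz.
rewrite (_ : (fun k => _) = (fun k => c^-1 * (c * r k ^+ 2))); last first.
  by apply/funext => k; rewrite mulKf// gt_eqF.
apply: cvgn_series_scale.
apply: (@cvgn_series_telescope _ _ b (fun k => `|x k - z| ^+ 2)) => // k.
by rewrite mulr_ge0 ?sqr_ge0// ltW.
Qed.

Lemma residual_cvg0 : r k @[k --> \oo] --> (0 : K).
Proof.
apply/cvgrPdistC_lt => a a0; have a20 : 0 < a ^+ 2 by rewrite exprn_gt0.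
have /cvgrPdistC_lt/(_ _ a20) := cvg_series_cvg_0 sqr_residual_summable.
apply: filterS => k; rewrite !subr0 ger0_norm ?sqr_ge0//.
by rewrite ltr_pXn2r ?nnegrE ?(ltW a0) ?(ltW (r_gt0 k))// gtr0_norm.
Qed.

(** After a last blind step [eta] would be constant and positive, and the vanishing
residuals would meet the test [r k <= c0 * eta k] again. *)
Lemma blind_infinite : 0 < c0 -> infinite_set [set k | r k <= c0 * eta k].
Proof.
move=> c0_gt0 fin.
have [N Nblind] : exists N, forall k, (N <= k)%N -> c0 * eta k < r k.
  have [N blindN] : exists N, forall k, r k <= c0 * eta k -> (k < N)%N.
    have [bs bsE] := (finite_seqP _).1 fin.
    exists (\max_(k <- bs) k).+1 => k rk; rewrite ltnS.
    have kbs : k \in bs by have : [set` bs] k by rewrite -bsE.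
    exact: (@leq_bigmax_seq _ bs xpredT id k).
  by exists N => k Nk; rewrite ltNge; apply/negP => /blindN; rewrite ltnNge Nk.
have etaN k : eta (N + k)%N = eta N.
  elim: k => [|k IHk]; first by rewrite addn0.
  rewrite addnS -IHk; case: (stepP (N + k)) => // h.
  by have := Nblind (N + k)%N (leq_addr _ _); rewrite ltNge h.
have c0N : 0 < c0 * eta N by rewrite mulr_gt0// eta_gt0.
have /cvgrPdistC_lt/(_ _ c0N)[m _ rm] := residual_cvg0.
have := rm (N + m)%N (leq_addl _ _); rewrite /= subr0 gtr0_norm//.
by have := Nblind (N + m)%N (leq_addr _ _); rewrite etaN => /ltW; rewrite leNgt => /negP.
Qed.

Section LinearRate.
Variables (gamma : K) (N : nat).
Hypothesis gamma_gt0 : 0 < gamma.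
Hypothesis subregular : forall k, (N <= k)%N -> dist (x k) S <= gamma * r k.

(** Let [delta] be the distance to [S]. No single quantity contracts at every step:
[delta] contracts at Fejer steps only, [eta] at blind steps only, and [s] at
educated steps only, up to [q^k]. The recursion is run on
[V = delta + A m + F c0 eta] with [m = min s (L delta)]. The truncation makes
[V] at most a constant times [delta] outside the blind steps, where
[c0 eta < r <= L delta], so there it suffices that [V] drops by a fraction of
[delta]. The weight [A] is chosen so that at an educated step, where
[r <= m], the new [delta] is paid for by the drop of [m], and [F] so that at a
blind step the new [delta + A m] is paid for by half of the drop of [eta]. *)
Lemma residual_geometric :
  exists C p, [/\ 0 < C, 0 < p < 1 & forall k, r k <= C * p ^+ k].
Proof.
have /andP[c00 c0_1] := c0_01; have /andP[c10 c1_1] := c1_01.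
have d0 : 0 < 1 - c0 by rewrite subr_gt0.
have d1 : 0 < 1 - c1 by rewrite subr_gt0.
have L0 := ltW L_gt0.
pose A := (gamma + D) / (1 - c1).
pose F := 2 * (1 + A * L) * (gamma + D) / (1 - c0).
(* Where [delta <= gamma * r], a Fejer step shrinks [delta^2]
at least by the factor [1 - t <= (1 - h)^2]. *)
pose t := c / (gamma ^+ 2 + c).
pose h := t / 2.
pose P := 1 + A * L + F * L.
pose rate := Num.max ((1 + c0) / 2) (1 - h / P).
pose delta k := dist (x k) S.
pose m k := Num.min (s k) (L * delta k).
pose V k := delta k + A * m k + F * (c0 * eta k).
have A0 : 0 <= A by rewrite divr_ge0 ?(ltW d1)// addr_ge0// ltW.
have AE : A * (1 - c1) = gamma + D by rewrite divfK ?gt_eqF.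
clearbody A.
have F0 : 0 <= F.
  have gD : 0 <= gamma + D by rewrite addr_ge0// ltW.
  have AL : 0 <= 1 + A * L by rewrite addr_ge0// mulr_ge0.
  by rewrite divr_ge0 ?(ltW d0)// mulr_ge0// mulr_ge0.
have FE : F * (1 - c0) = 2 * (1 + A * L) * (gamma + D) by rewrite divfK ?gt_eqF.
clearbody F.
have g2c : 0 < gamma ^+ 2 + c by rewrite addr_gt0 ?exprn_gt0.
have tE : t * (gamma ^+ 2 + c) = c by rewrite divfK ?gt_eqF.
have t0 : 0 < t by rewrite divr_gt0.
have t1 : t < 1 by rewrite ltr_pdivrMr// mul1r ltrDr exprn_gt0.
clearbody t.
have h0 : 0 < h by rewrite divr_gt0.
have h1 : h < 1 by rewrite /h; lra.
have P1 : 1 <= P by have := mulr_ge0 A0 L0; have := mulr_ge0 F0 L0; rewrite /P; lra.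
have rate01 : 0 <= rate < 1.
  have hP : 0 < h / P by rewrite divr_gt0//; lra.
  by rewrite le_max gt_max; apply/andP; split; [apply/orP; left|apply/andP; split]; lra.
have delta0 k : 0 <= delta k by exact: dist_ge0.
have m0 k : 0 <= m k by rewrite le_min s_ge0 mulr_ge0.
have V0 k : 0 <= V k.
  by rewrite !addr_ge0 ?mulr_ge0// ltW// eta_gt0.
have r_delta k : r k <= L * delta k.
  by rewrite -ler_pdivrMl//; apply: le_dist => // z Sz; rewrite ler_pdivrMl// r_le.
(* Outside the blind steps [V k <= P * delta k]. *)
have contract k a : c0 * eta k < r k -> 0 <= a -> V k.+1 <= V k - h * delta k + a ->
    V k.+1 <= rate * V k + a.
  move=> nb a_ge0 le_V.
  have VP : V k <= P * delta k.
    have : A * m k <= A * (L * delta k) by rewrite ler_wpM2l// ge_min lexx orbT.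
    have : F * (c0 * eta k) <= F * (L * delta k).
      by rewrite ler_wpM2l// (le_trans (ltW nb)).
    by rewrite /V /P; lra.
  have P_gt0 : 0 < P by lra.
  have VhP : h / P * V k <= h * delta k.
    by rewrite -mulrA ler_wpM2l ?(ltW h0)// ler_pdivrMl.
  have : (1 - h / P) * V k <= rate * V k.
    by rewrite ler_wpM2r// le_max lexx orbT.
  lra.
have V_rec k : (N <= k)%N -> V k.+1 <= rate * V k + A * q ^+ k.
  move=> Nk; have /andP[q0 q1] := q01.
  have qk0 : 0 <= A * q ^+ k by rewrite mulr_ge0 ?exprn_ge0.
  have far : `|x k.+1 - x k| <= D * r k -> delta k.+1 <= (gamma + D) * r k.
    move=> xx; apply: le_trans (dist_triangle S0 (x k) _) _.
    by have := subregular Nk; lra.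
  case: (stepP k) => [r_c0 etaE _ /far d_far|nb etaE rs /andP[_ s'_le] /far d_far
                     |nb etaE sE fejer _].
  - have AL0 : 0 <= 1 + A * L by rewrite addr_ge0 ?mulr_ge0.
    have Am : A * m k.+1 <= A * (L * delta k.+1).
      by rewrite ler_wpM2l// ge_min lexx orbT.
    have V'1 : V k.+1 <= F * ((1 + c0) / 2) * r k.
      have FE2 : (1 + A * L) * (gamma + D) = F * (1 - c0) / 2 by rewrite FE; lra.
      have d1' : (1 + A * L) * delta k.+1 <= F * (1 - c0) / 2 * r k.
        by rewrite -FE2 -[leRHS]mulrA ler_wpM2l.
      by rewrite /V etaE; lra.
    have Vk : F * (c0 * eta k) <= V k by rewrite /V lerDr addr_ge0// mulr_ge0.
    have rateV : (1 + c0) / 2 * V k <= rate * V k.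
      by rewrite ler_wpM2r// le_max lexx.
    have c2 : 0 <= (1 + c0) / 2 by lra.
    have := ler_wpM2l c2 Vk.
    have := ler_wpM2l (mulr_ge0 F0 c2) r_c0.
    lra.
  - apply: contract => //.
    have r_m : r k <= m k by rewrite le_min rs r_delta.
    have m' : m k.+1 <= c1 * m k + q ^+ k.
      rewrite ge_min; apply/orP; left; apply: le_trans s'_le _.
      by rewrite lerD2r ler_wpM2l.
    have gD : 0 <= gamma + D by rewrite addr_ge0// ltW.
    have := ler_wpM2l A0 m'; have := ler_wpM2l gD r_m; rewrite -AE.
    have := ler_wpM2r (delta0 k) (ltW h1).
    rewrite /V etaE -AE in d_far *; lra.
  - apply: contract => //.
    have cr0 : 0 <= c * r k ^+ 2 by rewrite mulr_ge0 ?sqr_ge0// ltW.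
    have d2 := dist_fejer S0 cr0 fejer; rewrite -/(delta k) -/(delta k.+1) in d2.
    have dg : delta k ^+ 2 <= gamma ^+ 2 * r k ^+ 2.
      rewrite -exprMn lerXn2r ?nnegrE//; last exact: subregular.
      by rewrite mulr_ge0// ltW.
    have tdg := ler_wpM2l (ltW t0) dg.
    have d_contr : delta k.+1 <= (1 - h) * delta k.
      have h1' : 0 <= 1 - h by lra.
      rewrite -(@ler_pXn2r _ 2%N) ?nnegrE ?mulr_ge0// exprMn.
      apply: le_trans d2 _.
      have : t * delta k ^+ 2 <= c * r k ^+ 2.
        have tg : t * gamma ^+ 2 = c - t * c by lra.
        apply: le_trans tdg _; rewrite mulrA tg.
        by have := mulr_ge0 (ltW t0) cr0; lra.
      have : 0 <= h ^+ 2 * delta k ^+ 2 by rewrite mulr_ge0 ?sqr_ge0.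
      rewrite /h; lra.
    have mm : m k.+1 <= m k.
      rewrite /m sE le_min ge_min lexx/= ge_min ler_wpM2l ?orbT//.
      apply: le_trans d_contr _.
      by have := mulr_ge0 (ltW h0) (delta0 k); lra.
    have := ler_wpM2l A0 mm.
    rewrite /V etaE; lra.
have [C [p [C0 p01 VC]]] := geometric_recurrence V0 A0 rate01 q01 V_rec.
exists ((L + 1) * C), p; split => //; first by rewrite mulr_gt0//; lra.
move=> k; apply: le_trans (r_delta k) _; rewrite -mulrA.
apply: (@le_trans _ _ (L * V k)).
  rewrite ler_wpM2l// /V -addrA lerDl addr_ge0// mulr_ge0//.
  by rewrite mulr_ge0// ltW// eta_gt0.
have Lk := ler_wpM2l L0 (VC k).
by have := VC k; have := V0 k; lra.
Qed.

(** Each step has length at most [(D + G) * r k], so the tail of the sequence is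
bounded by a geometric series. *)
Lemma iterates_R_linear xs : x k @[k --> \oo] --> xs -> R_linearly_cvg x xs.
Proof.
move=> xxs; have [C [p [C0 /andP[p0 p1] rC]]] := residual_geometric.
pose B := (D + G) * C / (1 - p).
have DG : 0 <= D + G by rewrite addr_ge0.
have p1' : 0 < 1 - p by rewrite subr_gt0.
have B0 : 0 <= B by rewrite divr_ge0 ?mulr_ge0// ltW.
have tail n k : `|x (k + n)%N - x k| <= B * p ^+ k.
  elim: n k => [|n IHn] k.
    by rewrite addn0 subrr normr0 mulr_ge0// exprn_ge0// ltW.
  rewrite addnS -addSn; apply: le_trans (ler_distD (x k.+1) _ _) _.
  have := step_length k; have := ler_wpM2l DG (rC k); have := IHn k.+1.
  have -> : B * p ^+ k = B * p ^+ k.+1 + (D + G) * C * p ^+ k.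
    by rewrite exprS /B; field; rewrite gt_eqF.
  lra.
exists (B + 1), p; split; rewrite ?p0//; first by rewrite ltr_wpDl.
move=> k; apply/ler_addgt0Pr => a a0.
have /cvgrPdistC_lt/(_ _ a0)[m _ xm] := xxs.
have := xm (k + m)%N (leq_addl _ _); rewrite /= => xkm.
apply: le_trans (ler_distD (x (k + m)%N) _ _) _.
have := tail m k; rewrite distrC; have : 0 <= p ^+ k by rewrite exprn_ge0// ltW.
lra.
Qed.

End LinearRate.
End StepAnalysis.

Theorem mainTheorem5 (K : realType) (H : completeNormedModType K)
    (ip : {dot H for idfun}) (T : H -> H)
    (alpha c0 c1 q beta sigma lambda D : K)
    (x d w : nat -> H) (eta rsafe tau : nat -> K)
    (ip_norm : induces_norm ip)
    (H_separable : separable_space H)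
    (alpha01 : 0 < alpha <= 1)
    (T_averaged : averaged alpha T)
    (fixT_neq0 : fixset T !=set0)
    (c0_01 : 0 <= c0 < 1) (c1_01 : 0 <= c1 < 1) (q_01 : 0 <= q < 1)
    (beta01 : 0 < beta < 1) (sigma01 : 0 < sigma < 1)
    (lambda01 : 0 < lambda < alpha^-1)
    (sm : superMann ip T alpha c0 c1 q beta sigma lambda x d w eta rsafe tau)
    (nosol : no_finite_solution ip T alpha c0 c1 beta sigma x d eta rsafe)
    (D_ge0 : 0 <= D)
    (d_le : forall k, `|d k| <= D * `|residual T (x k)|) :
  (* (i) *)
  quasi_Fejer x (fixset T) /\
  (* (ii), where the line search defining tau k terminates *)
  (forall k, ~ blind T c0 x eta k ->
     exists m, stops_at ip T alpha c1 beta sigma (x k) (rsafe k) (d k) m) /\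
  (forall k, d k = 0 -> tau k = 1) /\
  (forall k, d k <> 0 ->
     Num.min (beta * ((1 - sigma) / (4 * alpha * D))) 1 <= tau k) /\
  (* (iii) *)
  residual T (x k) @[k --> \oo] --> (0 : H) /\
  cvgn (series (fun k => `|residual T (x k)| ^+ 2)) /\
  (* (iv) *)
  (exists xs, fixset T xs /\ weakly_cvg ip x xs) /\
  (* (v) *)
  (0 < c0 -> infinite_set (blind T c0 x eta)) /\
  (* (vi) *)
  (finite_dimensional H -> exists xs : H, x k @[k --> \oo] --> xs) /\
  (forall xs : H, x k @[k --> \oo] --> xs ->
     metrically_subregular (residual T) xs ->
     R_linearly_cvg x xs /\ R_linearly_cvg (fun k => residual T (x k)) 0).
Proof.
have /andP[a0 a1] := alpha01; have /andP[l0 la] := lambda01.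
have /andP[s0 s1] := sigma01.
have T_ne := averaged_nonexpansive alpha01 T_averaged.
have term k : exists m, stops_at ip T alpha c1 beta sigma (x k) (rsafe k) (d k) m.
  exact: (line_search_terminates ip_norm alpha01 T_averaged _ beta01 sigma01 D_ge0).
have stepP := supermann_step ip_norm alpha01 T_averaged q_01 beta01 sigma01
  lambda01 D_ge0 sm nosol d_le.
have aD0 : 0 <= 4 * alpha * D by rewrite !mulr_ge0// ltW.
have G0 : 0 <= lambda * (1 + 4 * alpha * D).
  by rewrite mulr_ge0 ?(ltW l0)// addr_ge0.
have c_gt0 : 0 < lambda * (alpha^-1 - lambda) * sigma ^+ 2.
  by rewrite !mulr_gt0 ?exprn_gt0 ?subr_gt0.
have L_gt0 : 0 < 2 * alpha by rewrite mulr_gt0.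
have r_gt0 k : 0 < `|residual T (x k)|.
  by rewrite normr_gt0; apply/eqP; exact: nosol.1.
have r_le k z : fixset T z -> `|residual T (x k)| <= 2 * alpha * `|x k - z|.
  exact: residual_le_dist_fix.
have eta0 := sm_eta0 sm; have rsafe0 := sm_rsafe0 sm.
have R0 : residual T (x k) @[k --> \oo] --> (0 : H).
  apply/norm_cvg0P.
  exact: (residual_cvg0 fixT_neq0 c0_01 c1_01 q_01 D_ge0 c_gt0 L_gt0 r_gt0 r_le
    eta0 rsafe0 stepP).
have x_weak : exists2 xs, fixset T xs & weakly_cvg ip x xs.
  have [z Tz] := fixT_neq0.
  have [M _ xM] := dist_bounded c0_01 c1_01 q_01 c_gt0 r_gt0 eta0 rsafe0
    stepP Tz.
  apply: (opial ip_norm (M := M + `|z|)) => //.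
    move=> k; rewrite -{1}(subrK z (x k)); apply: le_trans (ler_normD _ _) _.
    by rewrite lerD2r.
  exact: (dist_cvg c0_01 c1_01 q_01 c_gt0 r_gt0 eta0 rsafe0 stepP).
split.
  exact: (iterates_quasi_fejer c0_01 c1_01 q_01 D_ge0 c_gt0 L_gt0 r_gt0 r_le
    eta0 rsafe0 stepP).
split; first by move=> k _; exact: term.
split.
  exact: (supermann_stepsize0 ip_norm alpha01 T_averaged beta01 sigma01 D_ge0 sm d_le).
split.
  exact: (supermann_stepsize ip_norm alpha01 T_averaged beta01 sigma01 D_ge0 sm d_le).
split=> //; split.
  exact: (sqr_residual_summable fixT_neq0 c0_01 c1_01 q_01 D_ge0 c_gt0 L_gt0
    r_gt0 r_le eta0 rsafe0 stepP).
split; first by have [xs Txs xxs] := x_weak; exists xs.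
split.
  exact: (blind_infinite fixT_neq0 c0_01 c1_01 q_01 D_ge0 c_gt0 L_gt0 r_gt0 r_le
    eta0 rsafe0 stepP).
split.
  move=> fd; have [xs _ xxs] := x_weak; exists xs.
  exact: (finite_dim_weak_strong ip_norm fd xxs).
move=> xs xxs [_ [e [gamma [e0 gamma0 subreg]]]].
have /cvgrPdistC_lt/(_ _ e0)[N _ xN] := xxs.
have subregN k : (N <= k)%N ->
    dist (x k) (fixset T) <= gamma * `|residual T (x k)|.
  by move=> Nk; rewrite -zer_residual; apply: subreg; exact: xN.
split.
  exact: (iterates_R_linear fixT_neq0 c0_01 c1_01 q_01 D_ge0 G0 c_gt0 L_gt0
    r_gt0 r_le eta0 rsafe0 stepP gamma0 subregN xxs).
have [C [p [C0 p01 rC]]] := residual_geometric fixT_neq0 c0_01 c1_01 q_01 D_ge0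
  c_gt0 L_gt0 r_gt0 r_le eta0 rsafe0 stepP gamma0 subregN.
by exists C, p; split=> // k; rewrite subr0.
Qed.
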